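(* Let $(\Gamma,d)$ be an inner first order differential calculus over $\mathcal A$, $da=\omega a-a\omega$ for $a\in\mathcal A$ with $\omega\in\Gamma$. Let $\mathcal C$ be an $\mathcal A$-bimodule and a left $\Gamma^\otimes$-module with left action $\mathrm m$. Suppose that $\nabla$ and $\nabla'$ are linear left connections on $\Gamma^\otimes$ and on the $\mathcal A$-bimodule $\mathcal C$, respectively, such that $$\nabla(\rho)=\omega\otimes_{\mathcal A}\rho-\tilde\sigma(\rho\otimes_{\mathcal A}\omega),\qquad \nabla'(\psi)=\omega\otimes_{\mathcal A}\psi-\tau(\psi\otimes_{\mathcal A}\omega)+V(\psi)$$ for $\rho\in\Gamma^\otimes$, $\psi\in\mathcal C$. Then $\nabla'$ is compatible with the left action $\mathrm m$ of $\Gamma^\otimes$ on $\mathcal C$ if and only if $$(\tau\,\mathrm m_{12}-\mathrm m_{23}\tilde\sigma_{12}\tau_{23})(\rho\otimes\psi\otimes\omega)+(\mathrm m_{23}\tilde\sigma_{12}V_2-V\mathrm m)(\rho\otimes\psi)=0$$ for all $\rho\in\Gamma$ and $\psi\in\mathcal C$.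
   Context: $\mathcal A$ is a cosemisimple Hopf $*$-algebra over $\mathbb C$; all first order differential calculi over $\mathcal A$ are left-covariant $*$-calculi. $\Gamma^\otimes=\bigoplus_{k\ge0}\Gamma^{\otimes_{\mathcal A}k}$ is the tensor algebra over $\mathcal A$. All tensor products in the claim are over $\mathcal A$. The left action $\mathrm m:\Gamma^\otimes\otimes_{\mathcal A}\mathcal C\to\mathcal C$ is an $\mathcal A$-bimodule map extending the left $\mathcal A$-action on $\mathcal C$. A left connection on an $\mathcal A$-bimodule $\mathcal C$ is a linear map $\nabla:\mathcal C\to\Gamma\otimes_{\mathcal A}\mathcal C$ with $\nabla(a\rho)=da\otimes\rho+a\nabla(\rho)$. It is a linear left connection on the bimodule $\mathcal C$ if there is a bimodule homomorphism $\tau:\mathcal C\otimes_{\mathcal A}\Gamma\to\Gamma\otimes_{\mathcal A}\mathcal C$ with $\tau(\rho\otimes da)=\nabla(\rho a)-\nabla(\rho)a$. If $\mathcal C$ is an $\mathcal A$-bimodule algebra with product $\circ$, a linear left connection on the algebra $\mathcal C$ with bimodule map $\tilde\sigma$ satisfies in addition $\nabla(\rho\circ\rho')=(\mathrm{id}\otimes\circ)(\nabla(\rho)\otimes\rho'+(\tilde\sigma\otimes\mathrm{id})(\rho\otimes\nabla(\rho')))$. For an inner calculus every linear left connection on a bimodule $\mathcal C$ has the form $\nabla'(\psi)=\omega\otimes\psi-\tau(\psi\otimes\omega)+V(\psi)$ with $\mathcal A$-bimodule homomorphisms $\tau:\mathcal C\otimes_{\mathcal A}\Gamma\to\Gamma\otimes_{\mathcal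 A}\mathcal C$ and $V:\mathcal C\to\Gamma\otimes_{\mathcal A}\mathcal C$; in the claim $\tilde\sigma:\Gamma^\otimes\otimes_{\mathcal A}\Gamma\to\Gamma\otimes_{\mathcal A}\Gamma^\otimes$, $\tau$, $V$ are such bimodule homomorphisms. $\nabla'$ is compatible with $\mathrm m$ if $\nabla'(\mathrm m(a\otimes\varphi))=(\mathrm{id}\otimes\mathrm m)\bigl(\nabla(a)\otimes\varphi+(\tilde\sigma\otimes\mathrm{id})(a\otimes\nabla'(\varphi))\bigr)$ for all $a\in\Gamma^\otimes$, $\varphi\in\mathcal C$. Subscripts denote the tensor legs on which a map acts (e.g. $\mathrm m_{12}$, $\tau_{23}$, $V_2$).
   Formalization: The formal theorem additionally assumes ∇(1) = 0, i.e. ∇ restricts to d on 𝒜 = degree zero of Γ^⊗; without it the ''if'' direction fails (σ̃ = 0, ∇(ρ) = ω⊗ρ, 𝒞 = 𝒜 with Γ acting by zero, τ(a⊗γ) = aγ⊗1, V = 0). *)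

(* Defs.v *)
From HB Require Import structures.
From mathcomp Require Import all_boot all_order all_algebra.
From mathcomp Require Import generic_quotient.
From mathcomp Require Import boolp reals.
From mathcomp Require Import complex.

Set Implicit Arguments.
Unset Strict Implicit.
Unset Printing Implicit Defensive.

Import GRing.Theory.
Local Open Scope ring_scope.
Local Open Scope quotient_scope.

(* The balanced tensor product of a right module [M] and a left module [N]:
   finite formal sums of pairs, modulo the usual relations.  Since
   -(x (x) y) = (-x) (x) y no coefficients are needed. *)
Section TensorProduct.
Variables (B : Type) (M N : zmodType) (ra : M -> B -> M) (la : B -> N -> N).

Inductive tens_rel : seq (M * N) -> seq (M * N) -> Prop :=
| tens_refl s : tens_rel s s
| tens_sym s t : tens_rel s t -> tens_rel t s
| tens_trans s t u : tens_rel s t -> tens_rel t u -> tens_rel s u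
| tens_cat s s' t t' :
    tens_rel s s' -> tens_rel t t' -> tens_rel (s ++ t) (s' ++ t')
| tens_comm s t : tens_rel (s ++ t) (t ++ s)
| tens_zero y : tens_rel [:: (0, y)] [::]
| tens_addl x x' y : tens_rel [:: (x + x', y)] [:: (x, y); (x', y)]
| tens_addr x y y' : tens_rel [:: (x, y + y')] [:: (x, y); (x, y')]
| tens_bal x b y : tens_rel [:: (ra x b, y)] [:: (x, la b y)].

Definition tens_relb (s t : seq (M * N)) : bool := `[< tens_rel s t >].

Lemma tens_relb_equiv : equiv_class_of tens_relb.
Proof.
split=> [s|s t|t s u /asboolP h1 /asboolP h2].
- exact/asboolP/tens_refl.
- by apply/asboolP/asboolP; apply: tens_sym.
- exact/asboolP/(tens_trans h1 h2).
Qed.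

Canonical tens_equiv := EquivRelPack tens_relb_equiv.

Definition tensor := {eq_quot tens_equiv}.
HB.instance Definition _ := Choice.on tensor.
HB.instance Definition _ := EqQuotient.on tensor.

Definition tens_cls (s : seq (M * N)) : tensor := \pi_tensor s.

Lemma tens_clsP s t : tens_cls s = tens_cls t <-> tens_rel s t.
Proof.
split=> [/eqP|h]; last by apply/eqP; rewrite /tens_cls eqmodE; apply/asboolP.
by rewrite /tens_cls eqmodE => /asboolP.
Qed.

Lemma tens_clsW (P : tensor -> Prop) : (forall s, P (tens_cls s)) -> forall t, P t.
Proof. by move=> h t; rewrite -[t]reprK; apply: h. Qed.

Lemma tens_repr (s : seq (M * N)) : tens_rel (repr (tens_cls s)) s.
Proof. by apply/tens_clsP; rewrite /tens_cls reprK. Qed.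

Let oppp (p : M * N) := (- p.1, p.2).

Lemma tens_rel_inv s : tens_rel (map oppp s ++ s) [::].
Proof.
elim: s => [|[x y] s0 IH] /=; first exact: tens_refl.
apply: (@tens_trans _ ([:: (- x, y); (x, y)] ++ (map oppp s0 ++ s0))).
  apply: (@tens_cat [:: (-x,y)] [:: (-x,y)]); first exact: tens_refl.
  apply: (@tens_trans _ (((x, y) :: s0) ++ map oppp s0)); first exact: tens_comm.
  apply: (@tens_cat [:: (x,y)] [:: (x,y)]); first exact: tens_refl.
  exact: tens_comm.
apply: (@tens_trans _ ([:: (0, y)] ++ [::])).
  by apply: tens_cat => //; apply: tens_sym; rewrite -{1}(addNr x); apply: tens_addl.
exact: tens_zero.
Qed.

Lemma tens_rel_opp s t :
  tens_rel s t -> tens_rel (map oppp s) (map oppp t).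
Proof.
move=> h.
apply: (@tens_trans _ (map oppp s ++ (map oppp t ++ t))).
  rewrite -{1}[map _ s]cats0; apply: tens_cat; first exact: tens_refl.
  exact/tens_sym/tens_rel_inv.
apply: (@tens_trans _ (map oppp s ++ (map oppp t ++ s))).
  by apply: tens_cat; [exact: tens_refl|apply: tens_cat; [exact: tens_refl|exact: tens_sym]].
apply: (@tens_trans _ (map oppp t ++ (map oppp s ++ s))).
  rewrite !catA; apply: tens_cat; last exact: tens_refl.
  exact: tens_comm.
rewrite -[X in tens_rel _ X]cats0; apply: tens_cat; first exact: tens_refl.
exact: tens_rel_inv.
Qed.

Definition tens_add (t u : tensor) : tensor := tens_cls (repr t ++ repr u).
Definition tens_opp (t : tensor) : tensor := tens_cls (map oppp (repr t)).

Lemma tens_addE s t : tens_add (tens_cls s) (tens_cls t) = tens_cls (s ++ t).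
Proof. by apply/tens_clsP/tens_cat; apply: tens_repr. Qed.

Lemma tens_oppE s : tens_opp (tens_cls s) = tens_cls (map oppp s).
Proof. exact/tens_clsP/tens_rel_opp/tens_repr. Qed.

Fact tens_addA : associative tens_add.
Proof.
elim/tens_clsW=> s; elim/tens_clsW=> t; elim/tens_clsW=> u.
by rewrite !tens_addE catA.
Qed.
Fact tens_addC : commutative tens_add.
Proof.
elim/tens_clsW=> s; elim/tens_clsW=> t; rewrite !tens_addE.
exact/tens_clsP/tens_comm.
Qed.
Fact tens_add0 : left_id (tens_cls [::]) tens_add.
Proof. by elim/tens_clsW=> s; rewrite tens_addE. Qed.
Fact tens_addN : left_inverse (tens_cls [::]) tens_opp tens_add.
Proof.
elim/tens_clsW=> s; rewrite tens_oppE tens_addE; apply/tens_clsP; exact: tens_rel_inv.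
Qed.

HB.instance Definition _ :=
  GRing.isZmodule.Build tensor tens_addA tens_addC tens_add0 tens_addN.

Definition tens (x : M) (y : N) : tensor := tens_cls [:: (x, y)].

Lemma tens_cls_cons p s : tens_cls (p :: s) = tens p.1 p.2 + tens_cls s.
Proof.
by case: p => x y; rewrite -[(x, y) :: s]/([:: (x, y)] ++ s) -tens_addE.
Qed.

Lemma tens_clsE s : tens_cls s = \sum_(p <- s) tens p.1 p.2.
Proof.
elim: s => [|p s IH]; first by rewrite big_nil.
by rewrite big_cons tens_cls_cons IH.
Qed.

Lemma tens_cls2 p q : tens_cls [:: p; q] = tens p.1 p.2 + tens q.1 q.2.
Proof. by rewrite tens_clsE !big_cons big_nil addr0. Qed.

Lemma tensDl x x' y : tens (x + x') y = tens x y + tens x' y.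
Proof. by rewrite -(tens_cls2 (x, y) (x', y)); apply/tens_clsP/tens_addl. Qed.

Lemma tensDr x y y' : tens x (y + y') = tens x y + tens x y'.
Proof. by rewrite -(tens_cls2 (x, y) (x, y')); apply/tens_clsP/tens_addr. Qed.

Lemma tens_balanced x b y : tens (ra x b) y = tens x (la b y).
Proof. exact/tens_clsP/tens_bal. Qed.

Lemma tens_ind (P : tensor -> Prop) :
  P 0 -> (forall t u, P t -> P u -> P (t + u)) -> (forall x y, P (tens x y)) ->
  forall t, P t.
Proof.
move=> P0 PD Pt; elim/tens_clsW=> s; rewrite tens_clsE.
by elim/big_ind: _ => // p _; apply: Pt.
Qed.

Definition balanced (P : zmodType) (f : M -> N -> P) : Prop :=
  [/\ forall x x' y, f (x + x') y = f x y + f x' y,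
      forall x y y', f x (y + y') = f x y + f x y'
    & forall x b y, f (ra x b) y = f x (la b y)].

(* The additive map [x (x) y |-> f x y]; only meaningful if [f] is balanced. *)
Definition tlift (P : zmodType) (f : M -> N -> P) (t : tensor) : P :=
  \sum_(p <- repr t) f p.1 p.2.

Section Lift.
Variables (P : zmodType) (f : M -> N -> P).
Hypothesis fP : balanced f.

Lemma tlift_cls s : tlift f (tens_cls s) = \sum_(p <- s) f p.1 p.2.
Proof.
case: fP => fDl fDr fb; rewrite /tlift.
suff key u v : tens_rel u v ->
    \sum_(p <- u) f p.1 p.2 = \sum_(p <- v) f p.1 p.2 by exact/key/tens_repr.
elim=> {u v} //=.
- by move=> s1 t1 u1 _ -> _ ->.
- by move=> s1 s2 t1 t2 _ e1 _ e2; rewrite !big_cat /= e1 e2.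
- by move=> ? ?; rewrite !big_cat /= addrC.
- move=> y; rewrite big_seq1 big_nil /=.
  by apply: (addrI (f 0 y)); rewrite -fDl !addr0.
- by move=> *; rewrite !big_cons !big_nil /= fDl !addr0.
- by move=> *; rewrite !big_cons !big_nil /= fDr !addr0.
- by move=> *; rewrite !big_cons !big_nil /= fb.
Qed.

Lemma tlift_tens x y : tlift f (tens x y) = f x y.
Proof. by rewrite /tens tlift_cls big_seq1. Qed.

Lemma tliftD t u : tlift f (t + u) = tlift f t + tlift f u.
Proof.
move: t u; elim/tens_clsW=> s; elim/tens_clsW=> t.
by rewrite [_ + _]tens_addE !tlift_cls big_cat.
Qed.

Lemma tlift0 : tlift f 0 = 0.
Proof. by apply: (addrI (tlift f 0)); rewrite -tliftD !addr0. Qed.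

End Lift.

Lemma tlift_unique (P : zmodType) (g h : tensor -> P) :
  {morph g : t u / t + u} -> {morph h : t u / t + u} ->
  (forall x y, g (tens x y) = h (tens x y)) -> g =1 h.
Proof.
move=> gD hD e; have g0 (k : tensor -> P) : {morph k : t u / t + u} -> k 0 = 0.
  by move=> kD; apply: (addrI (k 0)); rewrite -kD !addr0.
elim/tens_ind => [|t u IHt IHu|x y]; [by rewrite !g0|by rewrite gD hD IHt IHu|exact: e].
Qed.

End TensorProduct.
Arguments tlift {B M N ra la P}.

(* Keeps unification from unfolding the quotient construction. *)
#[global] Opaque tens_add tens_opp tens tlift.

(* Bimodules over a K-algebra [A], on which the two induced actions of K agree. *)
HB.mixin Record Lmodule_isBimodule (K : comNzRingType) (A : algType K) M
    of GRing.Lmodule A M := {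
  ract : M -> A -> M;
  ractA : forall x a b, ract (ract x a) b = ract x (a * b);
  ract1 : forall x, ract x 1 = x;
  ractDl : forall x y a, ract (x + y) a = ract x a + ract y a;
  ractDr : forall x a b, ract x (a + b) = ract x a + ract x b;
  ractZl : forall a x b, ract (a *: x) b = a *: ract x b;
  ract_scalar : forall x (k : K), ract x (k%:A) = (k%:A : A) *: x
}.

#[short(type="bimodType")]
HB.structure Definition Bimodule (K : comNzRingType) (A : algType K) :=
  { M of GRing.Lmodule A M & Lmodule_isBimodule K A M }.

Arguments ract {K A M} : rename.

Reserved Notation "x <* a" (at level 40, left associativity).
Reserved Notation "M ⊗ N" (at level 40, left associativity).
Reserved Notation "M ⊗k N" (at level 40, left associativity).
Notation "x <* a" := (ract x a) : ring_scope.

Section BimoduleTheory.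
Variables (K : comNzRingType) (A : algType K).

Definition bimod_hom (M N : bimodType A) (f : M -> N) : Prop :=
  linear f /\ forall x a, f (x <* a) = f x <* a.

Fact regular_ract_scalar (x : A^o) (k : K) : x * k%:A = (k%:A : A) *: x.
Proof. by rewrite -[RHS]/(k%:A * x) mulr_algl mulr_algr. Qed.
Fact regular_ractZl (a : A) (x : A^o) (b : A) : (a *: x) * b = a *: (x * b : A^o).
Proof. by rewrite -[RHS]/(a * (x * b)) mulrA. Qed.

HB.instance Definition _ := Lmodule_isBimodule.Build K A A^o
  (fun x a b => esym (mulrA x a b)) (@mulr1 A) (@mulrDl A) (@mulrDr A)
  regular_ractZl regular_ract_scalar.

Section TensorOverA.
Variables M N : bimodType A.

Definition tensorA := tensor (@ract K A M) (@GRing.scale A N).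
HB.instance Definition _ := GRing.Zmodule.on tensorA.

Definition tensA (x : M) (y : N) : tensorA := tens _ _ x y.

Local Notation "x ⊗ y" := (tensA x y) : ring_scope.

Let lact_fun (a : A) (x : M) (y : N) : tensorA := (a *: x) ⊗ y.
Let ract_fun (a : A) (x : M) (y : N) : tensorA := x ⊗ (y <* a).

Fact lact_balanced a : balanced (@ract K A M) (@GRing.scale A N) (lact_fun a).
Proof.
split=> [x x' y|x y y'|x b y]; rewrite /lact_fun /tensA.
- by rewrite scalerDr tensDl.
- by rewrite tensDr.
- by rewrite -ractZl tens_balanced.
Qed.

Fact ract_balanced a : balanced (@ract K A M) (@GRing.scale A N) (ract_fun a).
Proof.
split=> [x x' y|x y y'|x b y]; rewrite /ract_fun /tensA.
- by rewrite tensDl.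
- by rewrite ractDl tensDr.
- by rewrite tens_balanced -ractZl.
Qed.

Definition tensA_lact (a : A) : tensorA -> tensorA := tlift (fun x y => (a *: x) ⊗ y).
Definition tensA_ract (t : tensorA) (a : A) : tensorA := tlift (fun x y => x ⊗ (y <* a)) t.

Lemma tensA_lactE a x y : tensA_lact a (x ⊗ y) = (a *: x) ⊗ y.
Proof. exact: (tlift_tens (lact_balanced a)). Qed.
Lemma tensA_ractE a x y : tensA_ract (x ⊗ y) a = x ⊗ (y <* a).
Proof. exact: (tlift_tens (ract_balanced a)). Qed.
Lemma tensA_lactD a : {morph tensA_lact a : t u / t + u}.
Proof. exact: (tliftD (lact_balanced a)). Qed.
Lemma tensA_ractD a : {morph tensA_ract^~ a : t u / t + u}.
Proof. exact: (tliftD (ract_balanced a)). Qed.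

Fact tensA_lactA a b t : tensA_lact a (tensA_lact b t) = tensA_lact (a * b) t.
Proof.
move: t; apply: tlift_unique => [t u|t u|x y]; rewrite ?tensA_lactD //.
by rewrite !tensA_lactE scalerA.
Qed.
Fact tensA_lact1 : left_id 1 tensA_lact.
Proof.
apply: (@tlift_unique _ _ _ _ _ _ _ id) => [t u|t u|x y]; rewrite ?tensA_lactD //.
by rewrite tensA_lactE scale1r.
Qed.
Fact tensA_lactDr : right_distributive tensA_lact +%R.
Proof. by move=> a t u; rewrite tensA_lactD. Qed.
Fact tensA_lactDl t : {morph tensA_lact^~ t : a b / a + b}.
Proof.
move=> a b; move: t; apply: tlift_unique => [t u|t u|x y]; rewrite ?tensA_lactD //.
  by rewrite addrACA.
by rewrite !tensA_lactE scalerDl /tensA tensDl.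
Qed.

HB.instance Definition _ := GRing.Zmodule_isLmodule.Build A tensorA
  tensA_lactA tensA_lact1 tensA_lactDr tensA_lactDl.

Fact tensA_ractA t a b : tensA_ract (tensA_ract t a) b = tensA_ract t (a * b).
Proof.
move: t; apply: tlift_unique => [t u|t u|x y]; rewrite ?tensA_ractD //.
by rewrite !tensA_ractE ractA.
Qed.
Fact tensA_ract1 t : tensA_ract t 1 = t.
Proof.
move: t; apply: (@tlift_unique _ _ _ _ _ _ _ id) => [t u|t u|x y];
  rewrite ?tensA_ractD //.
by rewrite tensA_ractE ract1.
Qed.
Fact tensA_ractDl t u a : tensA_ract (t + u) a = tensA_ract t a + tensA_ract u a.
Proof. exact: tensA_ractD. Qed.
Fact tensA_ractDr t a b : tensA_ract t (a + b) = tensA_ract t a + tensA_ract t b.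
Proof.
move: t; apply: tlift_unique => [t u|t u|x y]; rewrite ?tensA_ractD //.
  by rewrite addrACA.
by rewrite !tensA_ractE ractDr /tensA tensDr.
Qed.
Fact tensA_ractZl a t b : tensA_ract (a *: t) b = a *: tensA_ract t b.
Proof.
move: t; apply: tlift_unique => [t u|t u|x y]; rewrite ?tensA_lactD ?scalerDr ?tensA_ractD ?scalerDr //.
by rewrite /GRing.scale /= !(tensA_lactE, tensA_ractE).
Qed.
Fact tensA_ract_scalar t (k : K) : tensA_ract t (k%:A) = (k%:A : A) *: t.
Proof.
move: t; apply: tlift_unique => [t u|t u|x y]; rewrite ?tensA_ractD ?scalerDr //.
rewrite /GRing.scale /= -/(_ *: _) tensA_lactE tensA_ractE ract_scalar.
by rewrite -(ract_scalar x) /tensA tens_balanced.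
Qed.

HB.instance Definition _ := Lmodule_isBimodule.Build K A tensorA
  tensA_ractA tensA_ract1 tensA_ractDl tensA_ractDr tensA_ractZl tensA_ract_scalar.

End TensorOverA.
End BimoduleTheory.
Arguments tensA {K A M N}.
Notation "M ⊗ N" := (tensorA M%type N%type) : type_scope.
Notation "x ⊗ y" := (tensA x y) : ring_scope.

Section TensorMaps.
Variables (K : comNzRingType) (A : algType K).

Definition tmap (M N M' N' : bimodType A) (f : M -> M') (g : N -> N')
  : M ⊗ N -> M' ⊗ N' := tlift (fun x y => f x ⊗ g y).

Definition tassoc (M N P : bimodType A) : (M ⊗ N) ⊗ P -> M ⊗ (N ⊗ P) :=
  tlift (fun t z => tlift (fun x y => x ⊗ (y ⊗ z)) t).

Definition tassocV (M N P : bimodType A) : M ⊗ (N ⊗ P) -> (M ⊗ N) ⊗ P :=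
  tlift (fun x t => tlift (fun y z => (x ⊗ y) ⊗ z) t).

Section TensLemmas.
Variables (M N : bimodType A).

Lemma tensADl (x x' : M) (y : N) : (x + x') ⊗ y = x ⊗ y + x' ⊗ y.
Proof. exact: tensDl. Qed.
Lemma tensADr (x : M) (y y' : N) : x ⊗ (y + y') = x ⊗ y + x ⊗ y'.
Proof. exact: tensDr. Qed.
Lemma tensA_bal (x : M) a (y : N) : (x <* a) ⊗ y = x ⊗ (a *: y).
Proof. exact: tens_balanced. Qed.
Lemma tensA_scale a (x : M) (y : N) : a *: (x ⊗ y) = (a *: x) ⊗ y.
Proof. exact: tensA_lactE. Qed.
Lemma tensA_ract_pure a (x : M) (y : N) : (x ⊗ y) <* a = x ⊗ (y <* a).
Proof. exact: tensA_ractE. Qed.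

Lemma tensA_ind (Q : M ⊗ N -> Prop) :
  Q 0 -> (forall t u, Q t -> Q u -> Q (t + u)) -> (forall x y, Q (x ⊗ y)) ->
  forall t, Q t.
Proof. exact: tens_ind. Qed.

Lemma ract0 (a : A) : (0 : M) <* a = 0.
Proof. by apply: (addrI ((0 : M) <* a)); rewrite -ractDl !addr0. Qed.

Lemma bimod_homD (f : M -> N) : bimod_hom f -> {morph f : x y / x + y}.
Proof. by case=> fl _ x y; rewrite -[x in LHS]scale1r fl scale1r. Qed.
Lemma bimod_hom0 (f : M -> N) : bimod_hom f -> f 0 = 0.
Proof. by move=> /bimod_homD fD; apply: (addrI (f 0)); rewrite -fD !addr0. Qed.
Lemma bimod_homZ (f : M -> N) : bimod_hom f -> forall a x, f (a *: x) = a *: f x.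
Proof.
by move=> fh a x; case: (fh) => fl _; rewrite -[a *: x]addr0 fl (bimod_hom0 fh) addr0.
Qed.
Lemma bimod_homR (f : M -> N) : bimod_hom f -> forall x a, f (x <* a) = f x <* a.
Proof. by case. Qed.

End TensLemmas.

Section TensorMapLemmas.
Variables (M N P M' N' : bimodType A).

Lemma tmap_balanced (f : M -> M') (g : N -> N') : bimod_hom f -> bimod_hom g ->
  balanced (@ract K A M) (@GRing.scale A N) (fun x y => f x ⊗ g y).
Proof.
move=> hf hg; split=> [x x' y|x y y'|x a y].
- by rewrite (bimod_homD hf) tensADl.
- by rewrite (bimod_homD hg) tensADr.
- by rewrite (bimod_homR hf) (bimod_homZ hg) tensA_bal.
Qed.

Lemma tmapE (f : M -> M') (g : N -> N') : bimod_hom f -> bimod_hom g ->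
  forall x y, tmap f g (x ⊗ y) = f x ⊗ g y.
Proof. by move=> hf hg x y; apply: (tlift_tens (tmap_balanced hf hg)). Qed.

Lemma tmapD (f : M -> M') (g : N -> N') : bimod_hom f -> bimod_hom g ->
  {morph tmap f g : t u / t + u}.
Proof. by move=> hf hg; apply: (tliftD (tmap_balanced hf hg)). Qed.

Lemma tmap_hom (f : M -> M') (g : N -> N') :
  bimod_hom f -> bimod_hom g -> bimod_hom (tmap f g).
Proof.
move=> hf hg; have tD := tmapD hf hg; have t0 := tlift0 (tmap_balanced hf hg).
split=> [a t u|t a].
  rewrite tD; congr (_ + _).
  elim/tensA_ind: t => [|t v et ev|x y]; first by rewrite scaler0 [LHS]t0 [tmap f g 0]t0 scaler0.
    by rewrite scalerDr !tD scalerDr et ev.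
  by rewrite tensA_scale !tmapE // (bimod_homZ hf) tensA_scale.
elim/tensA_ind: t => [|t v et ev|x y]; first by rewrite ract0 [LHS]t0 [tmap f g 0]t0 ract0.
  by rewrite ractDl !tD ractDl et ev.
by rewrite tensA_ract_pure !tmapE // (bimod_homR hg) tensA_ract_pure.
Qed.

Let assoc1 (z : P) : balanced (@ract K A M) (@GRing.scale A N)
  (fun x y => x ⊗ (y ⊗ z)).
Proof.
split=> [x x' y|x y y'|x a y]; rewrite ?tensADl ?tensADr //.
by rewrite tensA_bal tensA_scale.
Qed.

Let assoc2 : balanced (@ract K A (M ⊗ N)%type) (@GRing.scale A P)
  (fun t z => tlift (fun x y => x ⊗ (y ⊗ z)) t : M ⊗ (N ⊗ P)).
Proof.
split=> [t t' z|t z z'|t a z]; first exact: (tliftD (assoc1 z)).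
  move: t; apply: tlift_unique => [t u|t u|x y].
  - exact: (tliftD (assoc1 _)).
  - by rewrite (tliftD (assoc1 z)) (tliftD (assoc1 z')) addrACA.
  - by rewrite !(tlift_tens (assoc1 _)) !tensADr.
move: t; apply: tlift_unique => [t u|t u|x y].
- by rewrite ractDl (tliftD (assoc1 _)).
- exact: (tliftD (assoc1 _)).
rewrite -/(tensA x y) tensA_ract_pure !(tlift_tens (assoc1 _)).
by rewrite tensA_bal.
Qed.

Lemma tassocE (x : M) (y : N) (z : P) : tassoc ((x ⊗ y) ⊗ z) = x ⊗ (y ⊗ z).
Proof. by rewrite /tassoc (tlift_tens assoc2) (tlift_tens (assoc1 z)). Qed.

Lemma tassocD (t u : (M ⊗ N) ⊗ P) : tassoc (t + u) = tassoc t + tassoc u.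
Proof. exact: (tliftD assoc2). Qed.

Let assocV1 (x : M) : balanced (@ract K A N) (@GRing.scale A P)
  (fun y z => (x ⊗ y) ⊗ z).
Proof.
split=> [y y' z|y z z'|y a z]; rewrite ?tensADl ?tensADr ?tensADl //.
by rewrite -tensA_ract_pure tensA_bal.
Qed.

Let assocV2 : balanced (@ract K A M) (@GRing.scale A (N ⊗ P)%type)
  (fun x t => tlift (fun y z => (x ⊗ y) ⊗ z) t : (M ⊗ N) ⊗ P).
Proof.
split=> [x x' t|x t t'|x a t]; last first.
- move: t; apply: tlift_unique => [t u|t u|y z].
  + exact: (tliftD (assocV1 _)).
  + by rewrite scalerDr (tliftD (assocV1 _)).
  + rewrite -/(tensA y z) tensA_scale !(tlift_tens (assocV1 _)).
    by rewrite tensA_bal.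
- exact: (tliftD (assocV1 x)).
move: t; apply: tlift_unique => [t u|t u|y z].
- exact: (tliftD (assocV1 _)).
- by rewrite (tliftD (assocV1 x)) (tliftD (assocV1 x')) addrACA.
- by rewrite !(tlift_tens (assocV1 _)) !tensADl.
Qed.

Lemma tassocVE (x : M) (y : N) (z : P) : tassocV (x ⊗ (y ⊗ z)) = (x ⊗ y) ⊗ z.
Proof. by rewrite /tassocV (tlift_tens assocV2) (tlift_tens (assocV1 x)). Qed.

Lemma tassocVD (t u : M ⊗ (N ⊗ P)) : tassocV (t + u) = tassocV t + tassocV u.
Proof. exact: (tliftD assocV2). Qed.

Lemma tassoc_hom : bimod_hom (@tassoc M N P).
Proof.
have t0 : @tassoc M N P 0 = 0 by exact: (tlift0 assoc2).
split=> [a t u|t a].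
  rewrite tassocD; congr (_ + _).
  elim/tensA_ind: t => [|t v et ev|t z]; first by rewrite scaler0 t0 scaler0.
    by rewrite scalerDr !tassocD scalerDr et ev.
  elim/tensA_ind: t => [|t v et ev|x y].
  - have -> : (0 : M ⊗ N) ⊗ z = 0.
      by apply: (addrI ((0 : M ⊗ N) ⊗ z)); rewrite -tensADl !addr0.
    by rewrite scaler0 t0 scaler0.
  - by rewrite tensADl scalerDr !tassocD scalerDr et ev.
  - by rewrite !(tensA_scale, tassocE).
elim/tensA_ind: t => [|t v et ev|t z]; first by rewrite ract0 t0 ract0.
  by rewrite ractDl !tassocD ractDl et ev.
elim/tensA_ind: t => [|t v et ev|x y].
- have z0 z' : (0 : M ⊗ N) ⊗ (z' : P) = 0.
    by apply: (addrI ((0 : M ⊗ N) ⊗ z')); rewrite -tensADl !addr0.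
  by rewrite tensA_ract_pure !z0 t0 ract0.
- by rewrite tensADl ractDl !tassocD ractDl et ev.
- by rewrite !(tensA_ract_pure, tassocE).
Qed.

Lemma tassocV_hom : bimod_hom (@tassocV M N P).
Proof.
have t0 : @tassocV M N P 0 = 0 by exact: (tlift0 assocV2).
have r0 (x : M) : x ⊗ (0 : N ⊗ P) = 0.
  by apply: (addrI (x ⊗ (0 : N ⊗ P))); rewrite -tensADr !addr0.
split=> [a t u|t a].
  rewrite tassocVD; congr (_ + _).
  elim/tensA_ind: t => [|t v et ev|x t]; first by rewrite scaler0 t0 scaler0.
    by rewrite scalerDr !tassocVD scalerDr et ev.
  elim/tensA_ind: t => [|t v et ev|y z]; first by rewrite r0 scaler0 t0 scaler0.
  - by rewrite tensADr scalerDr !tassocVD scalerDr et ev.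
  - by rewrite !(tensA_scale, tassocVE).
elim/tensA_ind: t => [|t v et ev|x t]; first by rewrite ract0 t0 ract0.
  by rewrite ractDl !tassocVD ractDl et ev.
elim/tensA_ind: t => [|t v et ev|y z]; first by rewrite r0 ract0 t0 ract0.
- by rewrite tensADr ractDl !tassocVD ractDl et ev.
- by rewrite !(tensA_ract_pure, tassocVE).
Qed.

End TensorMapLemmas.
End TensorMaps.
#[global] Opaque tensA tensA_lact tensA_ract tmap tassoc tassocV.

(* The tensor algebra of the bimodule [G]: the direct sum over k of the tensor
   powers of [G] over [A].  By recursion the power k+1 is [G ⊗ (power k)], so that
   the first power is [G ⊗ A], identified with [G] through γ |-> γ ⊗ 1. *)
Section TensorAlgebra.
Variables (K : comNzRingType) (A : algType K) (G : bimodType A).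

Fixpoint tpow (k : nat) : bimodType A :=
  if k is k'.+1 then (G ⊗ tpow k')%type else A^o.

Record tensor_alg := TensorAlg {
  tcoef :> forall k, tpow k;
  tcoef_fin : exists n, forall k, (n <= k)%N -> tcoef k = 0
}.

HB.instance Definition _ := gen_eqMixin tensor_alg.
HB.instance Definition _ := gen_choiceMixin tensor_alg.

Lemma tensor_algP (s t : tensor_alg) : (forall k, s k = t k) -> s = t.
Proof.
case: s t => s sf [t tf] /= e; have {}e : s = t by exact: functional_extensionality_dep.
by case: t / e tf => tf; congr TensorAlg; exact: Prop_irrelevance.
Qed.

Implicit Types (s t u : tensor_alg) (a b : A) (g : G).

Fact ta_zero_fin : exists n, forall k, (n <= k)%N -> (0 : tpow k) = 0.
Proof. by exists 0%N. Qed.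
Definition ta_zero := TensorAlg ta_zero_fin.

Fact ta_add_fin s t : exists n, forall k, (n <= k)%N -> s k + t k = 0.
Proof.
case: (tcoef_fin s) (tcoef_fin t) => [n sn] [m tm]; exists (maxn n m) => k.
by rewrite geq_max => /andP[nk mk]; rewrite sn // tm // addr0.
Qed.
Definition ta_add s t := TensorAlg (ta_add_fin s t).

Fact ta_opp_fin s : exists n, forall k, (n <= k)%N -> - s k = 0.
Proof. by case: (tcoef_fin s) => n sn; exists n => k nk; rewrite sn ?oppr0. Qed.
Definition ta_opp s := TensorAlg (ta_opp_fin s).

Fact ta_addA : associative ta_add.
Proof. by move=> s t u; apply: tensor_algP => k /=; rewrite addrA. Qed.
Fact ta_addC : commutative ta_add.
Proof. by move=> s t; apply: tensor_algP => k /=; rewrite addrC. Qed.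
Fact ta_add0 : left_id ta_zero ta_add.
Proof. by move=> s; apply: tensor_algP => k /=; rewrite add0r. Qed.
Fact ta_addN : left_inverse ta_zero ta_opp ta_add.
Proof. by move=> s; apply: tensor_algP => k /=; rewrite addNr. Qed.
HB.instance Definition _ :=
  GRing.isZmodule.Build tensor_alg ta_addA ta_addC ta_add0 ta_addN.

Fact ta_lact_fin a s : exists n, forall k, (n <= k)%N -> a *: s k = 0.
Proof. by case: (tcoef_fin s) => n sn; exists n => k nk; rewrite sn ?scaler0. Qed.
Definition ta_lact a s := TensorAlg (ta_lact_fin a s).

Fact ta_lactA a b s : ta_lact a (ta_lact b s) = ta_lact (a * b) s.
Proof. by apply: tensor_algP => k /=; rewrite scalerA. Qed.
Fact ta_lact1 : left_id 1 ta_lact.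
Proof. by move=> s; apply: tensor_algP => k /=; rewrite scale1r. Qed.
Fact ta_lactDr : right_distributive ta_lact +%R.
Proof. by move=> a s t; apply: tensor_algP => k /=; rewrite scalerDr. Qed.
Fact ta_lactDl s : {morph ta_lact^~ s : a b / a + b}.
Proof. by move=> a b; apply: tensor_algP => k /=; rewrite scalerDl. Qed.
HB.instance Definition _ := GRing.Zmodule_isLmodule.Build A tensor_alg
  ta_lactA ta_lact1 ta_lactDr ta_lactDl.

Fact ta_ract_fin s a : exists n, forall k, (n <= k)%N -> s k <* a = 0.
Proof. by case: (tcoef_fin s) => n sn; exists n => k nk; rewrite sn ?ract0. Qed.
Definition ta_ract s a := TensorAlg (ta_ract_fin s a).

Fact ta_ractA s a b : ta_ract (ta_ract s a) b = ta_ract s (a * b).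
Proof. by apply: tensor_algP => k /=; rewrite ractA. Qed.
Fact ta_ract1 s : ta_ract s 1 = s.
Proof. by apply: tensor_algP => k /=; rewrite ract1. Qed.
Fact ta_ractDl s t a : ta_ract (s + t) a = ta_ract s a + ta_ract t a.
Proof. by apply: tensor_algP => k /=; rewrite ractDl. Qed.
Fact ta_ractDr s a b : ta_ract s (a + b) = ta_ract s a + ta_ract s b.
Proof. by apply: tensor_algP => k /=; rewrite ractDr. Qed.
Fact ta_ractZl a s b : ta_ract (a *: s) b = a *: ta_ract s b.
Proof. by apply: tensor_algP => k /=; rewrite ractZl. Qed.
Fact ta_ract_scalar s (c : K) : ta_ract s (c%:A) = (c%:A : A) *: s.
Proof. by apply: tensor_algP => k /=; rewrite ract_scalar. Qed.
HB.instance Definition _ := Lmodule_isBimodule.Build K A tensor_alg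
  ta_ractA ta_ract1 ta_ractDl ta_ractDr ta_ractZl ta_ract_scalar.

Lemma tcoef0 k : (0 : tensor_alg) k = 0. Proof. by []. Qed.
Lemma tcoefD s t k : (s + t) k = s k + t k. Proof. by []. Qed.
Lemma tcoef_scale a s k : (a *: s) k = a *: s k. Proof. by []. Qed.
Lemma tcoef_ract s a k : (s <* a) k = s k <* a. Proof. by []. Qed.
Lemma tcoef_sum n (F : nat -> tensor_alg) k :
  (\sum_(i < n) F i) k = \sum_(i < n) F i k.
Proof. by elim/big_ind2: _ => // s x t y <- <-; rewrite tcoefD. Qed.

(* [ta_homog x] is the element [x] of the k-th power, placed in degree k. *)
Definition ta_homog_fun k (x : tpow k) j : tpow j :=
  if @eqP _ k j is ReflectT e then eq_rect k tpow x j e else 0.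

Lemma ta_homog_funE k (x : tpow k) : ta_homog_fun x k = x.
Proof.
by rewrite /ta_homog_fun; case: eqP => // e; rewrite (eq_irrelevance e erefl).
Qed.
Lemma ta_homog_fun0 k (x : tpow k) j : k != j -> ta_homog_fun x j = 0.
Proof. by rewrite /ta_homog_fun; case: eqP. Qed.

Fact ta_homog_fin k (x : tpow k) :
  exists n, forall j, (n <= j)%N -> ta_homog_fun x j = 0.
Proof.
by exists k.+1 => j kj; apply: ta_homog_fun0; rewrite neq_ltn kj.
Qed.
Definition ta_homog k (x : tpow k) := TensorAlg (ta_homog_fin x).

(* Left multiplication by a generator γ of degree one. *)
Definition ta_shift_fun g s k : tpow k :=
  if k is k'.+1 then g ⊗ s k' else 0.
Lemma tens0r (M N : bimodType A) (x : M) : x ⊗ (0 : N) = 0.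
Proof. by apply: (addrI (x ⊗ 0)); rewrite -tensADr !addr0. Qed.
Fact ta_shift_fin g s : exists n, forall k, (n <= k)%N -> ta_shift_fun g s k = 0.
Proof.
case: (tcoef_fin s) => n sn; exists n.+1 => -[//|k] /= nk.
by rewrite sn // tens0r.
Qed.
Definition ta_shift g s := TensorAlg (ta_shift_fin g s).

(* Left multiplication by a homogeneous element:
   a . s = a *: s and (γ ⊗ x) . s = γ . (x . s). *)
Fixpoint ta_lmul k : tpow k -> tensor_alg -> tensor_alg :=
  if k is k'.+1 return tpow k -> tensor_alg -> tensor_alg
  then fun x s => tlift (fun g y => ta_shift g (ta_lmul y s)) x
  else fun a s => (a : A) *: s.

Lemma ta_shiftDl g g' s : ta_shift (g + g') s = ta_shift g s + ta_shift g' s.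
Proof. by apply: tensor_algP => -[|k] /=; rewrite ?addr0 ?tensADl. Qed.
Lemma ta_shiftDr g s t : ta_shift g (s + t) = ta_shift g s + ta_shift g t.
Proof. by apply: tensor_algP => -[|k] /=; rewrite ?addr0 ?tensADr. Qed.
Lemma ta_shift_bal g a s : ta_shift (g <* a) s = ta_shift g (a *: s).
Proof. by apply: tensor_algP => -[|k] //=; rewrite tensA_bal. Qed.
Lemma ta_shiftZ a g s : ta_shift (a *: g) s = a *: ta_shift g s.
Proof.
apply: tensor_algP => -[|k]; rewrite tcoef_scale /= ?scaler0 //.
by rewrite tensA_scale.
Qed.

Lemma ta_lmul_lin k :
  [/\ forall x y s, @ta_lmul k (x + y) s = ta_lmul x s + ta_lmul y s,
      forall x s t, @ta_lmul k x (s + t) = ta_lmul x s + ta_lmul x t,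
      forall a x s, @ta_lmul k (a *: x) s = a *: ta_lmul x s
    & forall s, balanced (@ract K A G) (@GRing.scale A (tpow k))
        (fun g y => ta_shift g (@ta_lmul k y s))].
Proof.
have bal j : (forall x y s, @ta_lmul j (x + y) s = ta_lmul x s + ta_lmul y s) ->
    (forall a x s, @ta_lmul j (a *: x) s = a *: ta_lmul x s) ->
    forall s, balanced (@ract K A G) (@GRing.scale A (tpow j))
        (fun g y => ta_shift g (@ta_lmul j y s)).
  move=> hD hZ s; split=> [x x' y|x y y'|x a y]; rewrite ?ta_shiftDl //.
  - by rewrite hD ta_shiftDr.
  - by rewrite ta_shift_bal hZ.
elim: k => [|k [IHl IHr IHZ IHb]].
  have hD (x y : tpow 0) s : ta_lmul (x + y) s = ta_lmul x s + ta_lmul y s.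
    exact: scalerDl.
  have hZ a (x : tpow 0) s : ta_lmul (a *: x) s = a *: ta_lmul x s.
    by rewrite /= scalerA.
  by split=> //; [move=> x s t; exact: scalerDr|exact: bal].
have hD (x y : tpow k.+1) s : ta_lmul (x + y) s = ta_lmul x s + ta_lmul y s.
  exact: (tliftD (IHb s)).
have hZ a (x : tpow k.+1) s : ta_lmul (a *: x) s = a *: ta_lmul x s.
  move: x; elim/tensA_ind => [|x y ex ey|g x].
  - rewrite scaler0; apply: (addrI (@ta_lmul k.+1 0 s)).
    rewrite -hD !addr0; have -> : @ta_lmul k.+1 0 s = 0; last by rewrite scaler0 addr0.
    exact: (tlift0 (IHb s)).
  - by rewrite scalerDr !hD scalerDr ex ey.
  - rewrite tensA_scale /= !(tlift_tens (IHb s)); exact: ta_shiftZ.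
split=> //; last exact: bal.
move=> x s t; move: x; elim/tensA_ind => [|x y ex ey|g x].
- by rewrite /= !(tlift0 (IHb _)) addr0.
- by rewrite !hD ex ey addrACA.
- by rewrite /= !(tlift_tens (IHb _)) IHr ta_shiftDr.
Qed.

Lemma ta_lmulDl k (x y : tpow k) s : ta_lmul (x + y) s = ta_lmul x s + ta_lmul y s.
Proof. by case: (ta_lmul_lin k). Qed.
Lemma ta_lmulDr k (x : tpow k) s t : ta_lmul x (s + t) = ta_lmul x s + ta_lmul x t.
Proof. by case: (ta_lmul_lin k). Qed.
Lemma ta_lmulZ k a (x : tpow k) s : ta_lmul (a *: x) s = a *: ta_lmul x s.
Proof. by case: (ta_lmul_lin k). Qed.
Lemma ta_lmulS k g (x : tpow k) s :
  @ta_lmul k.+1 (g ⊗ x) s = ta_shift g (ta_lmul x s).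
Proof. by case: (ta_lmul_lin k) => _ _ _ b; rewrite /= (tlift_tens (b s)). Qed.
Lemma ta_lmul0 k s : @ta_lmul k 0 s = 0.
Proof. by apply: (addrI (@ta_lmul k 0 s)); rewrite -ta_lmulDl !addr0. Qed.

Definition ta_bound s : nat := projT1 (cid (tcoef_fin s)).
Lemma ta_boundP s k : (ta_bound s <= k)%N -> s k = 0.
Proof. by rewrite /ta_bound; case: cid => n sn; exact: sn. Qed.

Definition ta_mul s t : tensor_alg := \sum_(k < ta_bound s) ta_lmul (s k) t.
Definition ta_one : tensor_alg := @ta_homog 0 (1 : A).

Lemma ta_mulE n s t : (forall k, (n <= k)%N -> s k = 0) ->
  ta_mul s t = \sum_(k < n) ta_lmul (s k) t.
Proof.
have widen m p : (forall k, (m <= k)%N -> s k = 0) -> (m <= p)%N ->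
    \sum_(k < m) ta_lmul (s k) t = \sum_(k < p) ta_lmul (s k) t.
  move=> sm mp; rewrite (big_ord_widen p (fun k => ta_lmul (s k) t)) //.
  rewrite big_mkcond; apply: eq_bigr => k _; case: ltnP => // mk.
  by rewrite sm // ta_lmul0.
move=> sn; rewrite /ta_mul (widen _ _ (@ta_boundP s) (leq_maxl _ n)).
by rewrite (widen _ _ sn (leq_maxr (ta_bound s) n)).
Qed.

Fact ta_mulDl : left_distributive ta_mul +%R.
Proof.
move=> s t u; pose n := maxn (ta_bound s) (ta_bound t).
have sn k : (n <= k)%N -> s k = 0.
  by rewrite geq_max => /andP[h _]; exact: ta_boundP.
have tn k : (n <= k)%N -> t k = 0.
  by rewrite geq_max => /andP[_ h]; exact: ta_boundP.
rewrite (ta_mulE _ sn) (ta_mulE _ tn) (@ta_mulE n) => [|k nk].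
  by rewrite -big_split; apply: eq_bigr => k _; rewrite tcoefD ta_lmulDl.
by rewrite tcoefD sn // tn // addr0.
Qed.

Fact ta_mulDr : right_distributive ta_mul +%R.
Proof.
move=> s t u; rewrite /ta_mul -big_split; apply: eq_bigr => k _.
by rewrite ta_lmulDr.
Qed.

Lemma ta_mulZl a s t : ta_mul (a *: s) t = a *: ta_mul s t.
Proof.
rewrite (ta_mulE _ (@ta_boundP s)) (@ta_mulE (ta_bound s)) => [|k sk].
  by rewrite scaler_sumr; apply: eq_bigr => k _; rewrite tcoef_scale ta_lmulZ.
by rewrite tcoef_scale ta_boundP // scaler0.
Qed.

Lemma ta_shift0 g : ta_shift g 0 = 0.
Proof. by apply: (addrI (ta_shift g 0)); rewrite -ta_shiftDr !addr0. Qed.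

Lemma ta_mul_shift g s t : ta_mul (ta_shift g s) t = ta_shift g (ta_mul s t).
Proof.
rewrite (@ta_mulE (ta_bound s).+1) => [|[//|k] /= sk]; last first.
  by rewrite ta_boundP // tens0r.
rewrite big_ord_recl ta_lmul0 add0r (ta_mulE _ (@ta_boundP s)).
elim: (ta_bound s) => [|n IH]; first by rewrite !big_ord0 ta_shift0.
by rewrite !big_ord_recr /= IH ta_shiftDr -ta_lmulS.
Qed.

Lemma ta_mul0 s : ta_mul 0 s = 0.
Proof. by apply: (addrI (ta_mul 0 s)); rewrite -ta_mulDl !addr0. Qed.

Lemma ta_lmul_mul k (x : tpow k) s t : ta_lmul x (ta_mul s t) = ta_mul (ta_lmul x s) t.
Proof.
elim: k x => [|k IH] x; first by rewrite /= ta_mulZl.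
move: x; elim/tensA_ind => [|x y ex ey|g x]; first by rewrite !ta_lmul0 ta_mul0.
  by rewrite !ta_lmulDl ta_mulDl ex ey.
by rewrite !ta_lmulS ta_mul_shift IH.
Qed.

Fact ta_mulA : associative ta_mul.
Proof.
move=> s t u; rewrite {1}/ta_mul {3}/ta_mul.
elim: (ta_bound s) => [|n IH]; first by rewrite !big_ord0 ta_mul0.
by rewrite !big_ord_recr /= IH ta_mulDl ta_lmul_mul.
Qed.

Fact ta_one_bound k : (1 <= k)%N -> ta_one k = 0.
Proof. by move=> k0; apply: ta_homog_fun0; rewrite neq_ltn k0. Qed.

Fact ta_mul1l : left_id ta_one ta_mul.
Proof.
move=> s; rewrite (ta_mulE _ ta_one_bound) big_ord1.
by rewrite [ta_one _]ta_homog_funE /= scale1r.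
Qed.

Lemma ta_lmul_homog k (x : tpow k) (y : A) :
  ta_lmul x (@ta_homog 0 y) = ta_homog (x <* y).
Proof.
elim: k x => [|k IH] x.
  apply: tensor_algP => -[|j]; last first.
    by rewrite /= ta_homog_fun0 // ta_homog_fun0 // scaler0.
  by rewrite /= !(@ta_homog_funE 0).
move: x; elim/tensA_ind => [|x x' ex ey|g x].
- rewrite ta_lmul0 ract0; apply: tensor_algP => j; rewrite tcoef0 /=.
  by case: (eqVneq k.+1 j) => [<-|h]; rewrite ?ta_homog_funE ?ta_homog_fun0.
- rewrite ta_lmulDl ex ey ractDl; apply: tensor_algP => j; rewrite tcoefD /=.
  by case: (eqVneq k.+1 j) => [<-|h]; rewrite ?ta_homog_funE ?ta_homog_fun0 // addr0.
- rewrite ta_lmulS IH; apply: tensor_algP => -[|j] /=.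
    by rewrite ta_homog_fun0.
  case: (eqVneq k j) => [<-|h]; first by rewrite !ta_homog_funE tensA_ract_pure.
  by rewrite !ta_homog_fun0 // tens0r.
Qed.

Lemma ta_sum_homog n s : (forall k, (n <= k)%N -> s k = 0) ->
  s = \sum_(k < n) ta_homog (s k).
Proof.
move=> sn; apply: tensor_algP => j; rewrite (tcoef_sum n (fun k => ta_homog (s k))).
case: (ltnP j n) => jn; last first.
  rewrite sn // big1 // => k _; apply: ta_homog_fun0.
  by rewrite neq_ltn (leq_trans (ltn_ord k) jn).
rewrite (bigD1 (Ordinal jn)) //= ta_homog_funE big1 ?addr0 // => k kj.
exact: ta_homog_fun0.
Qed.

Lemma ta_mul_homog0 s (a : A) : ta_mul s (@ta_homog 0 a) = s <* a.
Proof.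
rewrite [RHS](@ta_sum_homog (ta_bound s)) => [|k sk]; last first.
  by rewrite tcoef_ract ta_boundP // ract0.
by apply: eq_bigr => k _; rewrite ta_lmul_homog.
Qed.

Fact ta_mul1r : right_id ta_one ta_mul.
Proof. by move=> s; rewrite ta_mul_homog0 ract1. Qed.

Fact ta_one_neq0 : ta_one != 0.
Proof.
apply/eqP => /(congr1 (fun s : tensor_alg => s 0%N)).
by rewrite tcoef0 [ta_one _]ta_homog_funE => /eqP; rewrite (oner_eq0 A).
Qed.

HB.instance Definition _ := GRing.Zmodule_isNzRing.Build tensor_alg
  ta_mulA ta_mul1l ta_mul1r ta_mulDl ta_mulDr ta_one_neq0.

Definition ta_scalar (a : A) : tensor_alg := @ta_homog 0 a.
Definition ta_gen (g : G) : tensor_alg := @ta_homog 1 (g ⊗ (1 : A^o)).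

Lemma ta_scalar_mull a s : ta_scalar a * s = a *: s.
Proof.
rewrite -[LHS]/(ta_mul _ _) (@ta_mulE 1) => [|k k0].
  by rewrite big_ord1 [ta_scalar _ _]ta_homog_funE.
by apply: ta_homog_fun0; rewrite neq_ltn k0.
Qed.
Lemma ta_scalar_mulr a s : s * ta_scalar a = s <* a.
Proof. exact: ta_mul_homog0. Qed.

End TensorAlgebra.

Definition ta_prod (K : comNzRingType) (A : algType K) (G : bimodType A)
  : tensor_alg G ⊗ tensor_alg G -> tensor_alg G := tlift (fun s t => s * t).

(* Tensor products over the base ring K. *)
Section TensorOverK.
Variables (K : comNzRingType).

Definition tensorK (M N : lmodType K) :=
  tensor (fun (x : M) (k : K) => k *: x) (@GRing.scale K N).
HB.instance Definition _ (M N : lmodType K) := GRing.Zmodule.on (tensorK M N).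

Definition tensK (M N : lmodType K) (x : M) (y : N) : tensorK M N := tens _ _ x y.

Section Instance.
Variables M N : lmodType K.

Definition tensK_scale (k : K) : tensorK M N -> tensorK M N :=
  tlift (fun x y => tensK (k *: x) y).

Fact tensK_balanced k : balanced (fun (x : M) (c : K) => c *: x) (@GRing.scale K N)
  (fun x y => tensK (k *: x) y).
Proof.
split=> [x x' y|x y y'|x b y]; rewrite /tensK.
- by rewrite scalerDr tensDl.
- by rewrite tensDr.
- by rewrite -tens_balanced !scalerA mulrC.
Qed.

Lemma tensK_scaleE k x y : tensK_scale k (tensK x y) = tensK (k *: x) y.
Proof. exact: (tlift_tens (tensK_balanced k)). Qed.
Fact tensK_scaleDr : right_distributive tensK_scale +%R.
Proof. by move=> k t u; rewrite [LHS](tliftD (tensK_balanced k)). Qed.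
Fact tensK_scaleA a b t : tensK_scale a (tensK_scale b t) = tensK_scale (a * b) t.
Proof.
move: t; apply: tlift_unique => [t u|t u|x y]; rewrite ?tensK_scaleDr //.
by rewrite !tensK_scaleE scalerA.
Qed.
Fact tensK_scale1 : left_id 1 tensK_scale.
Proof.
apply: (@tlift_unique _ _ _ _ _ _ _ id) => [t u|t u|x y]; rewrite ?tensK_scaleDr //.
by rewrite tensK_scaleE scale1r.
Qed.
Fact tensK_scaleDl t : {morph tensK_scale^~ t : a b / a + b}.
Proof.
move=> a b; move: t; apply: tlift_unique => [t u|t u|x y]; rewrite ?tensK_scaleDr //.
  by rewrite addrACA.
by rewrite !tensK_scaleE scalerDl /tensK tensDl.
Qed.

HB.instance Definition _ := GRing.Zmodule_isLmodule.Build K (tensorK M N)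
  tensK_scaleA tensK_scale1 tensK_scaleDr tensK_scaleDl.

End Instance.

(* A module over the algebra [A], seen as a module over K. *)
Section Scalars.
Variables (A : algType K) (M : lmodType A).

Definition scalars : Type := M.
HB.instance Definition _ := GRing.Zmodule.on scalars.

Definition scalars_scale (k : K) (x : scalars) : scalars := (k%:A : A) *: (x : M).

Fact scalars_scaleA a b x :
  scalars_scale a (scalars_scale b x) = scalars_scale (a * b) x.
Proof. by rewrite /scalars_scale !scalerA mulr_algl scalerA. Qed.
Fact scalars_scale1 : left_id 1 scalars_scale.
Proof. by move=> x; rewrite /scalars_scale !scale1r. Qed.
Fact scalars_scaleDr : right_distributive scalars_scale +%R.
Proof. by move=> k x y; exact: scalerDr. Qed.
Fact scalars_scaleDl x : {morph scalars_scale^~ x : a b / a + b}.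
Proof. by move=> a b; rewrite /scalars_scale !scalerDl. Qed.

HB.instance Definition _ := GRing.Zmodule_isLmodule.Build K scalars
  scalars_scaleA scalars_scale1 scalars_scaleDr scalars_scaleDl.

End Scalars.
End TensorOverK.
Arguments tensK {K M N}.

Notation "M ⊗k N" := (tensorK M%type N%type) : type_scope.
Notation "x ⊗k y" := (tensK x y) : ring_scope.

(* Sweedler-style evaluation: with t = \sum_i x_i (x) y_i this is \sum_i E x_i y_i. *)
Reserved Notation "\sw_ ( x , y <- t ) E"
  (at level 36, E at level 36, x binder, y binder,
   format "\sw_ ( x ,  y  <-  t )  E").
Notation "\sw_ ( x , y <- t ) E" := (tlift (fun x y => E) t) : ring_scope.

Record hopf_star (R : realType) (A : algType R[i]) := HopfStar {
  comul : A -> A ⊗k A;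
  counit : A -> R[i];
  antipode : A -> A;
  star : A -> A;
  comul_linear : linear comul;
  comulA : forall a, \sw_(x, y <- comul a) (comul x ⊗k y)
    = \sw_(x, y <- comul a) \sw_(y1, y2 <- comul y) ((x ⊗k y1) ⊗k y2);
  counit_linear : scalar counit;
  counitl : forall a, \sw_(x, y <- comul a) (counit x *: y) = a;
  counitr : forall a, \sw_(x, y <- comul a) (counit y *: x) = a;
  comul1 : comul 1 = 1 ⊗k 1;
  comulM : forall a b, comul (a * b)
    = \sw_(x, y <- comul a) \sw_(z, w <- comul b) ((x * z) ⊗k (y * w));
  counit1 : counit 1 = 1;
  counitM : forall a b, counit (a * b) = counit a * counit b;
  antipode_linear : linear antipode;
  antipodel : forall a, \sw_(x, y <- comul a) (antipode x * y) = (counit a)%:A;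
  antipoder : forall a, \sw_(x, y <- comul a) (x * antipode y) = (counit a)%:A;
  starD : forall a b, star (a + b) = star a + star b;
  starZ : forall (k : R[i]) a, star (k *: a) = k^* *: star a;
  starM : forall a b, star (a * b) = star b * star a;
  starK : involutive star;
  comul_star : forall a, comul (star a) = \sw_(x, y <- comul a) (star x ⊗k star y)
}.

Section Cosemisimple.
Variables (R : realType) (A : algType R[i]) (H : hopf_star A).

Definition subcoalgebra (D : A -> Prop) : Prop :=
  [/\ D 0, forall (k : R[i]) a b, D a -> D b -> D (k *: a + b)
    & forall a, D a -> exists2 s : seq (A * A),
        forall p, p \in s -> D p.1 /\ D p.2
      & comul H a = \sum_(p <- s) (p.1 ⊗k p.2)].

Definition simple_subcoalgebra (D : A -> Prop) : Prop :=
  [/\ subcoalgebra D, exists2 a, D a & a <> 0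
    & forall E : A -> Prop, subcoalgebra E -> (forall a, E a -> D a) ->
        (forall a, E a -> a = 0) \/ (forall a, D a -> E a)].

Definition cosemisimple : Prop :=
  forall a : A, exists2 s : seq A,
    forall x, x \in s -> exists2 D, simple_subcoalgebra D & D x
  & a = \sum_(x <- s) x.

End Cosemisimple.

Section Calculus.
Variables (R : realType) (A : algType R[i]) (H : hopf_star A).
Variables (G : bimodType A) (d : A -> G).

Definition first_order_calculus : Prop :=
  [/\ linear (d : A -> scalars G),
      forall a b, d (a * b) = d a <* b + a *: d b
    & forall g : G, exists s : seq (A * A), g = \sum_(p <- s) p.1 *: d p.2].

Definition left_covariant : Prop := exists delta : G -> A ⊗k scalars G,
  [/\ linear (delta : scalars G -> A ⊗k scalars G),
      forall r, \sw_(x, g <- delta r) (comul H x ⊗k g)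
        = \sw_(x, g <- delta r) \sw_(y, h <- delta g) ((x ⊗k y) ⊗k h),
      forall r, \sw_(x, g <- delta r) (counit H x *: g) = r,
      forall a r b, delta (a *: r <* b)
        = \sw_(a1, a2 <- comul H a) \sw_(x, g <- delta r) \sw_(b1, b2 <- comul H b)
            ((a1 * x * b1) ⊗k (a2 *: (g : G) <* b2 : scalars G))
    & forall a, delta (d a)
        = \sw_(a1, a2 <- comul H a) (a1 ⊗k (d a2 : scalars G))].

Definition star_calculus : Prop := exists starG : G -> G,
  [/\ forall g h, starG (g + h) = starG g + starG h,
      forall (k : R[i]) g, starG ((k%:A : A) *: g) = ((k^*)%:A : A) *: starG g,
      involutive starG,
      forall a g b, starG (a *: g <* b) = star H b *: starG g <* star H a
    & forall a, starG (d a) = d (star H a)].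

Definition left_covariant_star_calculus : Prop :=
  [/\ first_order_calculus, left_covariant & star_calculus].

End Calculus.

Section Connections.
Variables (K : comNzRingType) (A : algType K) (G : bimodType A) (d : A -> G).

(* [f] acting on the tensor legs 1 and 2 (the map written f_12). *)
Definition leg12 (M N M' N' P : bimodType A) (f : M ⊗ N -> M' ⊗ N')
  (t : M ⊗ (N ⊗ P)) : M' ⊗ (N' ⊗ P) := tassoc (tmap f id (tassocV t)).

Section Module.
Variables (M : bimodType A) (nabla : M -> G ⊗ M).

Definition left_connection : Prop :=
  linear (nabla : scalars M -> scalars (G ⊗ M)%type) /\
  forall a x, nabla (a *: x) = d a ⊗ x + a *: nabla x.

Definition linear_left_connection_with (tau : M ⊗ G -> G ⊗ M) : Prop :=
  [/\ left_connection, bimod_hom tau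
    & forall x a, tau (x ⊗ d a) = nabla (x <* a) - nabla x <* a].

Definition linear_left_connection : Prop :=
  exists tau, linear_left_connection_with tau.

End Module.

(* For an action [m] this is the compatibility of the two connections with [m];
   for M = C and a product [m] it is the Leibniz rule. *)
Definition compatible (C M : bimodType A) (m : C ⊗ M -> M) (nabC : C -> G ⊗ C)
    (nabM : M -> G ⊗ M) (sigma : C ⊗ G -> G ⊗ C) : Prop :=
  forall x y, nabM (m (x ⊗ y))
    = tmap id m (tassoc (nabC x ⊗ y) + leg12 sigma (x ⊗ nabM y)).

Definition algebra_connection_with (C : bimodType A) (mu : C ⊗ C -> C)
    (nabla : C -> G ⊗ C) (sigma : C ⊗ G -> G ⊗ C) : Prop :=
  linear_left_connection_with nabla sigma /\ compatible mu nabla nabla sigma.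

Definition left_action (M : bimodType A) (m : tensor_alg G ⊗ M -> M) : Prop :=
  [/\ bimod_hom m,
      forall (a : A) x, m (ta_scalar G a ⊗ x) = a *: x
    & forall (s t : tensor_alg G) x, m ((s * t) ⊗ x) = m (s ⊗ m (t ⊗ x))].

End Connections.

(* Main.v *)
Require Import Defs.
From mathcomp Require Import all_boot all_order all_algebra.
From mathcomp Require Import reals complex.

(** Substituting the inner forms of [nabla] and [nabla'] into the compatibility
    equation at [s ⊗ x], the terms with [omega] in the first leg cancel, and so do the
    two terms with [sigma (s ⊗ omega)]; what remains is the stated identity with [s]
    in place of a generator ([inner_compatible_at]).  This holds for every [s] in the tensor algebra, so the
    direct implication is the case where [s] has degree one.

    For the converse, it suffices that the elements [s] at which compatibility holds
    for all [x] form a subring containing [A], because the tensor algebra is generated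
    by [A] and [G] ([tensor_alg_gen_ind]).
    - Degree zero: [nabla 1 = 0] and the generation of [G] by exact forms give
      [sigma (a ⊗ g) = (a *: g) ⊗ 1] ([sigma_scalar]), and compatibility becomes the
      left Leibniz rule of [nabla'] ([compatible_at_scalar]).
    - Products: the Leibniz rule of [nabla], compared at [st <* b] and [st], gives the
      hexagon identity: [sigma] at [(s * t) ⊗ g] moves [g] past [t], then past [s], and
      multiplies ([sigma_mul]).  Together with associativity of the action this turns
      the compatibility equations at [s] and [t] into the one at [s * t]
      ([compatible_at_mul]). *)

Set Implicit Arguments.
Unset Strict Implicit.
Unset Printing Implicit Defensive.

Import GRing.Theory.
Local Open Scope ring_scope.

(** * Additive maps and balanced tensors *)

Section AdditiveMaps.
Variables (U W : zmodType) (f : U -> W).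
Hypothesis fD : {morph f : x y / x + y}.

Lemma morphD0 : f 0 = 0.
Proof. by apply: (addrI (f 0)); rewrite -fD !addr0. Qed.

Lemma morphDB : {morph f : x y / x - y}.
Proof. by move=> x y; apply: (addIr (f y)); rewrite -fD !subrK. Qed.

End AdditiveMaps.

Lemma cancel_inner_terms (U : zmodType) (w p q r u v : U) :
  w - p + v = w - q + (q - r + u) <-> p - r + (u - v) = 0.
Proof.
have -> : w - q + (q - r + u) = w + (- r + u).
  by rewrite -[q - r + u]addrA [LHS]addrA subrK.
rewrite -[w - p + v]addrA -[p - r + _]addrA [- r + (u - v)]addrA [p + _]addrA.
split=> [e|/subr0_eq h]; last by rewrite -h addKr.
by rewrite -(addrI w e) [p + _]addrA subrr add0r subrr.
Qed.

Section BalancedTensors.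
Variables (K : comNzRingType) (A : algType K).

Lemma bimod_hom_id (M : bimodType A) : bimod_hom (@id M).
Proof. by split. Qed.

Lemma bimod_hom_comp (M N P : bimodType A) (f : N -> P) (g : M -> N) :
  bimod_hom f -> bimod_hom g -> bimod_hom (fun x => f (g x)).
Proof.
move=> hf hg; split=> [a x y|x a]; last by rewrite !bimod_homR.
by rewrite (bimod_homD hg) (bimod_homZ hg) (bimod_homD hf) (bimod_homZ hf).
Qed.

Lemma tens0Al (M N : bimodType A) (y : N) : (0 : M) ⊗ y = 0.
Proof. by apply: (@morphD0 _ _ (fun x : M => x ⊗ y)) => x x'; rewrite tensADl. Qed.

Lemma tensABl (M N : bimodType A) (x x' : M) (y : N) :
  (x - x') ⊗ y = x ⊗ y - x' ⊗ y.
Proof. by apply: (@morphDB _ _ (fun x : M => x ⊗ y)) => z z'; rewrite tensADl. Qed.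

Lemma tensABr (M N : bimodType A) (x : M) (y y' : N) :
  x ⊗ (y - y') = x ⊗ y - x ⊗ y'.
Proof. by apply: (@morphDB _ _ (fun y : N => x ⊗ y)) => z z'; rewrite tensADr. Qed.

Lemma bimod_homB (M N : bimodType A) (f : M -> N) :
  bimod_hom f -> {morph f : x y / x - y}.
Proof. by move=> hf; apply/morphDB/bimod_homD. Qed.

Lemma tassocB (M N P : bimodType A) (t u : (M ⊗ N) ⊗ P) :
  tassoc (t - u) = tassoc t - tassoc u.
Proof. exact/bimod_homB/tassoc_hom. Qed.

Section Leg12.
Variables (M N M' N' P : bimodType A) (f : M ⊗ N -> M' ⊗ N').
Hypothesis f_hom : bimod_hom f.

Lemma leg12E x y (z : P) : leg12 f (x ⊗ (y ⊗ z)) = tassoc (f (x ⊗ y) ⊗ z).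
Proof. by rewrite /leg12 tassocVE tmapE. Qed.

Lemma leg12_hom : bimod_hom (@leg12 _ _ M N M' N' P f).
Proof.
apply: bimod_hom_comp (@tassoc_hom _ _ _ _ _) _.
apply: bimod_hom_comp (@tassocV_hom _ _ _ _ _).
by apply: tmap_hom => //; apply: bimod_hom_id.
Qed.

End Leg12.
End BalancedTensors.

(** * Products and generators of the tensor algebra *)

Section TensorAlgebraProduct.
Variables (K : comNzRingType) (A : algType K) (G : bimodType A).
Local Notation T := (tensor_alg G).

(** Both actions of [A] on the tensor algebra are multiplications by scalars,
    so balancedness is associativity. *)
Lemma ta_prod_balanced :
  balanced (@ract K A T) (@GRing.scale A T) (fun s t : T => s * t).
Proof.
split=> [s s' t|s t t'|s a t]; first exact: mulrDl.
  exact: mulrDr.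
by rewrite -ta_scalar_mulr -ta_scalar_mull mulrA.
Qed.

Lemma ta_prodE (s t : T) : ta_prod (s ⊗ t) = s * t.
Proof. exact: (tlift_tens ta_prod_balanced). Qed.

Lemma ta_prod_hom : bimod_hom (@ta_prod _ A G).
Proof.
have pD : {morph @ta_prod _ A G : t u / t + u} by exact: (tliftD ta_prod_balanced).
have p0 : @ta_prod _ A G 0 = 0 by exact: morphD0.
split=> [a t u|t a].
  rewrite pD; congr (_ + _).
  elim/tensA_ind: t => [|t v et ev|x y]; first by rewrite scaler0 p0 scaler0.
    by rewrite scalerDr !pD scalerDr et ev.
  by rewrite tensA_scale !ta_prodE -!ta_scalar_mull mulrA.
elim/tensA_ind: t => [|t v et ev|x y]; first by rewrite ract0 p0 ract0.
  by rewrite ractDl !pD ractDl et ev.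
by rewrite tensA_ract_pure !ta_prodE -!ta_scalar_mulr mulrA.
Qed.

Lemma ta_gen_mul_homog g k (x : tpow G k) :
  ta_gen g * ta_homog x = ta_homog (g ⊗ x : tpow G k.+1).
Proof.
(* A generator vanishes from degree two on, so the product has two terms. *)
rewrite -[LHS]/(ta_mul _ _) (@ta_mulE _ _ _ 2) => [|j j2]; last first.
  by apply: ta_homog_fun0; rewrite neq_ltn j2.
have gen0 : ta_gen g 0%N = 0 by apply: ta_homog_fun0.
have gen1 : ta_gen g 1%N = g ⊗ (1 : A^o) by apply: ta_homog_funE.
rewrite big_ord_recl big_ord1 gen0 ta_lmul0 add0r [ta_gen g _]gen1.
rewrite (@ta_lmulS _ _ _ 0%N) /= scale1r.
apply: tensor_algP => -[|j] /=; first by rewrite ta_homog_fun0.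
case: (eqVneq k j) => [<-|kj]; first by rewrite !ta_homog_funE.
by rewrite !ta_homog_fun0 // tens0r.
Qed.

Lemma ta_homogD k (x y : tpow G k) : ta_homog (x + y) = ta_homog x + ta_homog y.
Proof.
apply: tensor_algP => j; rewrite tcoefD /=.
by case: (eqVneq k j) => [<-|kj]; rewrite ?ta_homog_funE // !ta_homog_fun0 // addr0.
Qed.

(** The tensor algebra is generated by degrees zero and one.  The inductive step
    multiplies by a generator on the left because power k+1 is [G ⊗ (power k)]. *)
Lemma tensor_alg_gen_ind (Q : T -> Prop) :
  (forall a : A, Q (ta_scalar G a)) ->
  (forall s t, Q s -> Q t -> Q (s + t)) ->
  (forall g s, Q s -> Q (ta_gen g * s)) ->
  forall s, Q s.
Proof.
move=> Q_scalar QD Qgen s.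
have homog0 k : ta_homog (0 : tpow G k) = 0.
  exact: morphD0 (@ta_homogD k).
have Q0 : Q 0 by rewrite -(homog0 0); apply: Q_scalar.
rewrite (ta_sum_homog (@ta_boundP _ _ _ s)).
elim/big_ind: _ => // i _; elim: (nat_of_ord i) (s i) => [|k IH] x.
  exact: Q_scalar.
elim/tensA_ind: x => [|x y Qx Qy|g x].
- by rewrite homog0.
- by rewrite ta_homogD; apply: QD.
- by rewrite -ta_gen_mul_homog; apply/Qgen/IH.
Qed.

End TensorAlgebraProduct.

(** * Compatibility of connections with an action of the tensor algebra *)

Section Actions.
Variables (K : comNzRingType) (A : algType K) (G : bimodType A) (d : A -> G).
Local Notation T := (tensor_alg G).
Hypothesis d_generates : forall g : G, exists s : seq (A * A),
  g = \sum_(p <- s) p.1 *: d p.2.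
Variables (sigma : T ⊗ G -> G ⊗ T) (nabla : T -> G ⊗ T).
Hypothesis nabla_conn : algebra_connection_with d (@ta_prod _ A G) nabla sigma.
Hypothesis nabla1 : nabla 1 = 0.

Lemma exact_form_ind (Q : G -> Prop) :
  Q 0 -> (forall g h, Q g -> Q h -> Q (g + h)) -> (forall a b, Q (a *: d b)) ->
  forall g, Q g.
Proof.
by move=> Q0 QD Qd g; case: (d_generates g) => s ->; elim/big_ind: _.
Qed.

Lemma sigma_hom : bimod_hom sigma.
Proof. by case: nabla_conn => -[]. Qed.

Lemma sigma_exact s a : sigma (s ⊗ d a) = nabla (s <* a) - nabla s <* a.
Proof. by case: nabla_conn => -[]. Qed.

Lemma nablaZ a s : nabla (a *: s) = d a ⊗ s + a *: nabla s.
Proof. by case: nabla_conn => -[[]]. Qed.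

Lemma nablaD : {morph nabla : s t / s + t}.
Proof.
case: nabla_conn => -[[nl _] _ _] _ s t.
by have := nl 1 s t; rewrite !scale1r.
Qed.

Lemma nabla_scalar a : nabla (ta_scalar G a) = d a ⊗ (1 : T).
Proof. by rewrite -[ta_scalar G a]mulr1 ta_scalar_mull nablaZ nabla1 scaler0 addr0. Qed.

(** On degree zero, [sigma] is the canonical flip: [nabla 1 = 0] forces
    [sigma (1 ⊗ d b) = nabla (b *: 1) = d b ⊗ 1], and exact forms generate [G]. *)
Lemma sigma_scalar a g : sigma (ta_scalar G a ⊗ g) = (a *: g) ⊗ (1 : T).
Proof.
have s1 : sigma ((1 : T) ⊗ g) = g ⊗ (1 : T).
  elim/exact_form_ind: g => [|g h eg eh|b c].
  - by rewrite tens0r tens0Al (bimod_hom0 sigma_hom).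
  - by rewrite tensADr (bimod_homD sigma_hom) eg eh tensADl.
  rewrite -tensA_bal -ta_scalar_mulr mul1r -[ta_scalar _ b]mulr1 ta_scalar_mull.
  rewrite -[in LHS]tensA_scale (bimod_homZ sigma_hom) sigma_exact nabla1 ract0 subr0.
  by rewrite -ta_scalar_mulr mul1r nabla_scalar tensA_scale.
rewrite -[ta_scalar G a]mulr1 ta_scalar_mull -[in LHS]tensA_scale.
by rewrite (bimod_homZ sigma_hom) s1 tensA_scale.
Qed.

Local Notation prod23 := (tmap (@id G) (@ta_prod _ A G)).

Lemma prod23_hom : bimod_hom prod23.
Proof. by apply: tmap_hom; [apply: bimod_hom_id|apply: ta_prod_hom]. Qed.

(** The hexagon identity for [sigma].  On an exact form the Leibniz rule for
    [nabla] expands [sigma (st ⊗ d b) = nabla (st <* b) - nabla (st) <* b], where the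
    terms containing [nabla s] cancel.  These forms suffice, since the coefficient of
    [a *: d b] can be absorbed into [t]. *)
Lemma sigma_mul (s t : T) g :
  sigma ((s * t : T) ⊗ g) = prod23 (leg12 sigma (s ⊗ sigma (t ⊗ g))).
Proof.
have hs := sigma_hom; have h12 := leg12_hom T sigma_hom; have h23 := prod23_hom.
elim/exact_form_ind: g t => [|g h eg eh|a b] t.
- by rewrite !(tens0r, bimod_hom0 hs, bimod_hom0 h12, bimod_hom0 h23).
- by rewrite !(tensADr, bimod_homD hs, bimod_homD h12, bimod_homD h23) eg eh.
(* The coefficient moves across the tensor sign into [t], which is why the
   induction keeps [t] general. *)
rewrite -!tensA_bal -ta_scalar_mulr -mulrA ta_scalar_mulr.
move: (t <* a) => {a}t; rewrite !sigma_exact.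
case: nabla_conn => _ leibniz.
have n_mul (x y : T) : nabla (x * y) =
    prod23 (tassoc (nabla x ⊗ y)) + prod23 (leg12 sigma (x ⊗ nabla y)).
  by rewrite -ta_prodE leibniz (bimod_homD h23).
rewrite -ta_scalar_mulr -mulrA ta_scalar_mulr !n_mul ractDl.
rewrite tensABr (bimod_homB h12) (bimod_homB h23).
have hR : tassoc (nabla s ⊗ (t <* b)) = tassoc (nabla s ⊗ t) <* b.
  by rewrite -tensA_ract_pure (bimod_homR (tassoc_hom _ _ _)).
rewrite hR (bimod_homR h23) -!tensA_ract_pure (bimod_homR h12) (bimod_homR h23).
by rewrite opprD addrACA subrr add0r.
Qed.

Variables (M : bimodType A) (m : T ⊗ M -> M).
Hypothesis m_action : left_action m.
Local Notation m23 := (tmap (@id G) m).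

Lemma action_hom : bimod_hom m. Proof. by case: m_action. Qed.

Lemma m23_hom : bimod_hom m23.
Proof. by apply: tmap_hom; [apply: bimod_hom_id|apply: action_hom]. Qed.

Lemma m23E g t : m23 (g ⊗ t) = g ⊗ m t.
Proof. by rewrite tmapE //; apply: action_hom. Qed.

(** Associativity of the action on legs two and three, with an arbitrary tensor
    in place of a pure one. *)
Lemma m23_assoc (u : G ⊗ T) t x :
  m23 (tassoc (u ⊗ m (t ⊗ x))) = m23 (tassoc (prod23 (tassoc (u ⊗ t)) ⊗ x)).
Proof.
have hM := m23_hom; have hP := prod23_hom.
elim/tensA_ind: u => [|u v eu ev|g s].
- by rewrite !(tens0Al, bimod_hom0 (tassoc_hom _ _ _), bimod_hom0 hP, bimod_hom0 hM).
- by rewrite !(tensADl, tassocD, bimod_homD hP, bimod_homD hM) eu ev.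
rewrite !tassocE m23E tmapE; [|exact: bimod_hom_id|exact: ta_prod_hom].
by rewrite ta_prodE tassocE m23E; case: m_action => _ _ ->.
Qed.

Lemma m23_sigma_action s (u : G ⊗ T) x :
  m23 (leg12 sigma (s ⊗ m23 (tassoc (u ⊗ x))))
  = m23 (tassoc (prod23 (leg12 sigma (s ⊗ u)) ⊗ x)).
Proof.
have hM := m23_hom; have hP := prod23_hom.
have h12 N := leg12_hom N sigma_hom.
elim/tensA_ind: u => [|u v eu ev|g t].
- by rewrite !(tens0Al, tens0r, bimod_hom0 (tassoc_hom _ _ _), bimod_hom0 hP,
    bimod_hom0 hM, bimod_hom0 (h12 _)).
- rewrite !(tensADl, tensADr, tassocD, bimod_homD hP, bimod_homD hM,
    bimod_homD (h12 _)).
  by rewrite eu ev.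
by rewrite tassocE m23E !(leg12E sigma_hom) m23_assoc.
Qed.

(** Applying compatibility at [t] and then at [s] flips a form twice; the hexagon
    identity merges the two flips into the one required at [s * t]. *)
Lemma m23_sigma_mul (s t : T) (v : G ⊗ M) :
  m23 (leg12 sigma (s ⊗ m23 (leg12 sigma (t ⊗ v))))
  = m23 (leg12 sigma ((s * t : T) ⊗ v)).
Proof.
have hM := m23_hom; have h12 N := leg12_hom N sigma_hom.
elim/tensA_ind: v => [|v w ev ew|g y].
- by rewrite !(tens0r, bimod_hom0 hM, bimod_hom0 (h12 _)).
- by rewrite !(tensADr, bimod_homD hM, bimod_homD (h12 _)) ev ew.
by rewrite !(leg12E sigma_hom) m23_sigma_action sigma_mul.
Qed.

Variable nabla' : M -> G ⊗ M.
Hypothesis nabla'_conn : left_connection d nabla'.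

(** Compatibility with the first argument fixed: the elements [s] satisfying it
    turn out to form a subring. *)
Definition compatible_at (s : T) : Prop := forall x, nabla' (m (s ⊗ x))
  = m23 (tassoc (nabla s ⊗ x) + leg12 sigma (s ⊗ nabla' x)).

(** As [nabla a = d a ⊗ 1] and [sigma] flips [a ⊗ g] into [(a *: g) ⊗ 1],
    compatibility in degree zero is the left Leibniz rule of [nabla']. *)
Lemma compatible_at_scalar a : compatible_at (ta_scalar G a).
Proof.
move=> x; have [_ m_scalar _] := m_action.
rewrite m_scalar nabla_scalar tassocE (bimod_homD m23_hom) m23E.
(* The unit of the tensor algebra is by definition the scalar 1. *)
rewrite -[1](erefl : ta_scalar G 1 = 1) m_scalar scale1r.
case: nabla'_conn => _ ->; congr (_ + _).
have hM := m23_hom; have h12 := leg12_hom M sigma_hom.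
elim/tensA_ind: (nabla' x) => [|v w ev ew|g y].
- by rewrite scaler0 tens0r (bimod_hom0 h12) (bimod_hom0 hM).
- by rewrite scalerDr tensADr (bimod_homD h12) (bimod_homD hM) ev ew.
rewrite (leg12E sigma_hom) sigma_scalar tassocE m23E tensA_scale.
by rewrite -[1](erefl : ta_scalar G 1 = 1) m_scalar scale1r.
Qed.

Lemma compatible_atD s t :
  compatible_at s -> compatible_at t -> compatible_at (s + t).
Proof.
move=> cs ct x; have [nl _] := nabla'_conn.
have n'D : {morph nabla' : y z / y + z}.
  by move=> y z; have := nl 1 y z; rewrite !scale1r.
rewrite !(tensADl, bimod_homD action_hom) n'D cs ct nablaD !tensADl tassocD.
by rewrite !(bimod_homD m23_hom, bimod_homD (leg12_hom _ sigma_hom)) addrACA.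
Qed.

(** Apply compatibility at [s] to the vector [m (t ⊗ x)], then at [t] to [x].
    The result is the Leibniz expansion of [nabla (s * t)] acting on [x], followed by
    a double flip which the hexagon identity turns into one flip past [s * t]. *)
Lemma compatible_at_mul s t :
  compatible_at s -> compatible_at t -> compatible_at (s * t).
Proof.
move=> cs ct x; have [_ _ m_mul] := m_action.
have h12 N := leg12_hom N sigma_hom.
rewrite m_mul cs ct [in RHS](bimod_homD m23_hom) -m23_sigma_mul.
have [_ leibniz] := nabla_conn.
rewrite -ta_prodE leibniz (bimod_homD prod23_hom) tensADl tassocD.
rewrite !(tensADr, bimod_homD m23_hom, bimod_homD (h12 _)).
by rewrite m23_assoc m23_sigma_action addrA.
Qed.

Lemma compatible_from_generators :
  (forall g, compatible_at (ta_gen g)) -> compatible m nabla nabla' sigma.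
Proof.
move=> c_gen; elim/tensor_alg_gen_ind => [a|s t|g s cs].
- exact: compatible_at_scalar.
- exact: compatible_atD.
- exact: compatible_at_mul (c_gen g) cs.
Qed.

(** The two copies of [omega ⊗ m (s ⊗ x)] cancel, and so do the two copies of
    [m23 (sigma (s ⊗ omega) ⊗ x)], one coming from [nabla s] and the other from the
    leading term [omega ⊗ x] of [nabla' x]. *)
Lemma inner_compatible_at omega (tau : M ⊗ G -> G ⊗ M) (V : M -> G ⊗ M) :
  (forall s, nabla s = omega ⊗ s - sigma (s ⊗ omega)) ->
  (forall x, nabla' x = omega ⊗ x - tau (x ⊗ omega) + V x) ->
  forall s, compatible_at s <-> forall x,
    (tau (m (s ⊗ x) ⊗ omega) - m23 (leg12 sigma (s ⊗ tau (x ⊗ omega))))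
    + (m23 (leg12 sigma (s ⊗ V x)) - V (m (s ⊗ x))) = 0.
Proof.
move=> nablaE nabla'E s.
have hM := m23_hom; have h12 := leg12_hom M sigma_hom.
suff E x : (nabla' (m (s ⊗ x))
     = m23 (tassoc (nabla s ⊗ x) + leg12 sigma (s ⊗ nabla' x))) <->
    (tau (m (s ⊗ x) ⊗ omega) - m23 (leg12 sigma (s ⊗ tau (x ⊗ omega))))
    + (m23 (leg12 sigma (s ⊗ V x)) - V (m (s ⊗ x))) = 0.
  by split=> h x; apply/E/h.
rewrite !nabla'E nablaE tensABl tassocB tassocE tensADr tensABr.
rewrite (bimod_homD h12) (bimod_homB h12) (leg12E sigma_hom).
rewrite (bimod_homD hM) (bimod_homB hM) (bimod_homD hM) (bimod_homB hM) m23E.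
exact: cancel_inner_terms.
Qed.

End Actions.

Theorem proposition4p5 (R : realType) (A : algType R[i]) (H : hopf_star A)
    (A_cosemisimple : cosemisimple H)
    (G : bimodType A) (d : A -> G)
    (Gd_calculus : left_covariant_star_calculus H d)
    (omega : G) (d_inner : forall a : A, d a = omega <* a - a *: omega)
    (M : bimodType A) (m : tensor_alg G ⊗ M -> M) (m_action : left_action m)
    (sigma : tensor_alg G ⊗ G -> G ⊗ tensor_alg G)
    (nabla : tensor_alg G -> G ⊗ tensor_alg G)
    (nabla_conn : algebra_connection_with d (@ta_prod _ A G) nabla sigma)
    (nabla1 : nabla 1 = 0)
    (tau : M ⊗ G -> G ⊗ M) (tau_hom : bimod_hom tau)
    (V : M -> G ⊗ M) (V_hom : bimod_hom V)
    (nabla' : M -> G ⊗ M) (nabla'_conn : linear_left_connection d nabla')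
    (nablaE : forall rho : tensor_alg G,
       nabla rho = omega ⊗ rho - sigma (rho ⊗ omega))
    (nabla'E : forall psi : M,
       nabla' psi = omega ⊗ psi - tau (psi ⊗ omega) + V psi) :
  compatible m nabla nabla' sigma <->
  forall (rho : G) (psi : M),
    let m12 : (tensor_alg G ⊗ M) ⊗ G -> M ⊗ G := tmap m id in
    let m23 : G ⊗ (tensor_alg G ⊗ M) -> G ⊗ M := tmap id m in
    let sigma12 : tensor_alg G ⊗ (G ⊗ M) -> G ⊗ (tensor_alg G ⊗ M) :=
      leg12 sigma in
    let tau23 : (tensor_alg G ⊗ M) ⊗ G -> tensor_alg G ⊗ (G ⊗ M) :=
      fun t => tmap id tau (tassoc t) in
    let V2 : tensor_alg G ⊗ M -> tensor_alg G ⊗ (G ⊗ M) := tmap id V in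
    let rho_psi := ta_gen rho ⊗ psi in
    (tau (m12 (rho_psi ⊗ omega)) - m23 (sigma12 (tau23 (rho_psi ⊗ omega))))
    + (m23 (sigma12 (V2 rho_psi)) - V (m rho_psi)) = 0.
Proof.
have [[_ _ d_generates] _ _] := Gd_calculus.
have left_conn' : left_connection d nabla' by case: nabla'_conn => tau' [].
have hm := action_hom m_action.
have atE := inner_compatible_at nabla_conn m_action nablaE nabla'E.
have legsE rho psi :
  [/\ tmap m id ((ta_gen rho ⊗ psi) ⊗ omega) = m (ta_gen rho ⊗ psi) ⊗ omega,
      tmap id tau (tassoc ((ta_gen rho ⊗ psi) ⊗ omega))
        = ta_gen rho ⊗ tau (psi ⊗ omega)
    & tmap id V (ta_gen rho ⊗ psi) = ta_gen rho ⊗ V psi].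
  by split; rewrite ?tassocE tmapE.
split=> [c rho psi /=|F].
  by have [-> -> ->] := legsE rho psi; apply: (atE (ta_gen rho)).1 => x; apply: c.
apply: (compatible_from_generators d_generates nabla_conn nabla1 m_action left_conn').
move=> rho; apply/atE => psi.
by have := F rho psi; rewrite /=; have [-> -> ->] := legsE rho psi.
Qed.
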